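(* The class $\mathcal{O}$ of all orthodox semigroups is an $\{\mathsf{E},\mathsf{H},\mathsf{P}\}$-class of semigroups, defined by the following equation system: a semigroup $S$ is orthodox if and only if for all $a,b\in S$ there exist $x,y\in S$ such that $x\in V(a)$, $y\in V(b)$, and for every choice of (not necessarily distinct) $g_1,g_2,g_3\in F=\{ax,xa,by,yb\}$ the product $p=g_1g_2g_3$ is an idempotent of $S$.
   Context: For a semigroup $S$ and $a\in S$, $V(a)=\{x\in S: axa=a,\ xax=x\}$ is the set of inverses of $a$; $E(S)$ is the set of idempotents of $S$. $S$ is regular if for every $a\in S$ there is $x\in S$ with $axa=a$. A semigroup is orthodox if it is regular and its idempotents form a subsemigroup, i.e. $ef\in E(S)$ for all $e,f\in E(S)$. The condition in the theorem is an equation system, i.e. a prenex first-order sentence in the language of one binary operation whose matrix is a finite conjunction of equalities of words (the condition $p\in E(S)$ is the equality $p=p^2$). An $\{\mathsf{E},\mathsf{H},\mathsf{P}\}$-class is a class closed under $\mathsf{E}$ (if $A$ embeds elementarily in a member $B$ of the class, then $A$ is in the class), $\mathsf{H}$ (homomorphic images) and $\mathsf{P}$ (direct products). *)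

(* Defs.v *)
From HB Require Import structures.
From mathcomp Require Import all_boot.
From mathcomp Require Import classical_sets.

Set Implicit Arguments.
Unset Strict Implicit.
Unset Printing Implicit Defensive.

Local Open Scope classical_set_scope.
Local Open Scope group_scope.

(* The structures for the language of one binary operation are the magmas.
   A semigroup is taken to be an associative magma rather than a
   [semigroupType], because the latter also carries a [choiceType]
   structure. *)

Definition semigroup (S : magmaType) : Prop := associative (@mul S).

Section Orthodox.
Variable S : magmaType.

Definition inverses (a : S) : set S :=
  [set x | a * x * a = a /\ x * a * x = x].

Definition idempotents : set S := [set e | e = e * e].

Definition regular : Prop := forall a : S, exists x, a * x * a = a.

Definition orthodox : Prop :=
  [/\ semigroup S, regular &
      forall e f, idempotents e -> idempotents f -> idempotents (e * f)].

End Orthodox.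

(* Formulas are well scoped: [formula n] has its free variables among
   0, ..., n-1, and a quantifier in front of a [formula n.+1] binds the
   variable n.  Hence the i-th quantifier of a prenex sentence binds the
   variable i, and an empty structure needs no special treatment. *)

Inductive word (n : nat) : Type :=
| Var of 'I_n
| Mul of word n & word n.

Inductive formula (n : nat) : Type :=
| Eq of word n & word n
| Not of formula n
| And of formula n & formula n
| Or of formula n & formula n
| Imp of formula n & formula n
| All of formula n.+1
| Ex of formula n.+1.

Fixpoint eval (M : magmaType) n (v : 'I_n -> M) (t : word n) : M :=
  match t with
  | Var i => v i
  | Mul t1 t2 => eval v t1 * eval v t2
  end.

Definition extend (T : Type) n (v : 'I_n -> T) (x : T) (i : 'I_n.+1) : T :=
  oapp v x (unlift ord_max i).

Fixpoint holds (M : magmaType) n (v : 'I_n -> M) (phi : formula n) : Prop :=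
  match phi in formula _ with
  | Eq t u => eval v t = eval v u
  | Not p => ~ holds v p
  | And p q => holds v p /\ holds v q
  | Or p q => holds v p \/ holds v q
  | Imp p q => holds v p -> holds v q
  | All p => forall x, holds (extend v x) p
  | Ex p => exists x, holds (extend v x) p
  end.

Definition empty_valuation (T : Type) (i : 'I_0) : T :=
  match notF (ltn_ord i) with end.

Definition satisfies (M : magmaType) (phi : formula 0) : Prop :=
  holds (@empty_valuation M) phi.

Fixpoint equality_conjunction n (phi : formula n) : bool :=
  match phi with
  | Eq _ _ => true
  | And p q => equality_conjunction p && equality_conjunction q
  | _ => false
  end.

Fixpoint prenex_equalities n (phi : formula n) : bool :=
  match phi with
  | All p | Ex p => prenex_equalities p
  | _ => equality_conjunction phi
  end.

Definition equation_system (phi : formula 0) : bool := prenex_equalities phi.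

Definition elementary_embedding (A B : magmaType) (f : A -> B) : Prop :=
  forall n (phi : formula n) (v : 'I_n -> A),
    holds v phi <-> holds (f \o v) phi.

Definition direct_product (I : Type) (A : I -> magmaType) : Type :=
  forall i, A i.

HB.instance Definition _ (I : Type) (A : I -> magmaType) :=
  hasMul.Build (direct_product A) (fun a b i => a i * b i).

Definition E_closed (C : magmaType -> Prop) : Prop :=
  forall (A B : magmaType) (f : A -> B), elementary_embedding f -> C B -> C A.

Definition H_closed (C : magmaType -> Prop) : Prop :=
  forall (A B : magmaType) (f : {multiplicative A -> B}),
    (forall b, exists a, f a = b) -> C A -> C B.

Definition P_closed (C : magmaType -> Prop) : Prop :=
  forall (I : Type) (A : I -> magmaType),
    (forall i, C (A i)) -> C (direct_product A : magmaType).

Definition EHP_class_of_semigroups (C : magmaType -> Prop) : Prop :=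
  [/\ forall S, C S -> semigroup S, E_closed C, H_closed C & P_closed C].

Definition orthodox_condition (S : magmaType) : Prop :=
  forall a b : S, exists x y : S,
    [/\ inverses a x, inverses b y &
        let F := [set a * x; x * a; b * y; y * b] in
        forall g1 g2 g3, F g1 -> F g2 -> F g3 ->
          idempotents (g1 * g2 * g3)].

(* The sentence expressing [orthodox_condition], as a formal object. *)
Definition orthodox_system : formula 0 :=
  let a := Var (@Ordinal 4 0 isT) in
  let b := Var (@Ordinal 4 1 isT) in
  let x := Var (@Ordinal 4 2 isT) in
  let y := Var (@Ordinal 4 3 isT) in
  let m := @Mul 4 in
  let F := [:: m a x; m x a; m b y; m y b] in
  let ps := [seq m (m g12.1 g12.2) g3
            | g12 <- [seq (g1, g2) | g1 <- F, g2 <- F], g3 <- F] in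
  All (All (Ex (Ex
    (foldr (@And 4) (Eq (m (m a x) a) a)
      ([:: Eq (m (m x a) x) x; Eq (m (m b y) b) b; Eq (m (m y b) y) y]
         ++ [seq Eq p (m p p) | p <- ps]))))).

(* Main.v *)
Require Import Defs.
From mathcomp Require Import all_boot.
From mathcomp Require Import boolp classical_sets.

(** The closure properties come from the shape of the defining sentences.
Truth of a first-order sentence passes to elementary substructures.  A prenex
sentence whose matrix is a conjunction of equalities is positive, hence passes
to homomorphic images, and witnesses for its existential quantifiers can be
chosen coordinatewise, hence it passes to direct products.  Associativity is
itself such a sentence, so it suffices to show that the given system defines
the orthodox semigroups among all semigroups.

One direction is immediate: in an orthodox semigroup the elements of [F] are
idempotents for any choice of inverses [x] of [a] and [y] of [b].

For the converse, two idempotents [e], [f] and an inverse [z] of [e * f] give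
an idempotent [g = f * z * e] of which [e * f] is an inverse
([mul_idempotents_inverse]).  So orthodoxy follows once every inverse [c] of
an idempotent [g] is idempotent.  The system for the pair [(c, g)] provides
[x] in [V(c)] and [y] in [V(g)], and the point is that
[c = (c * x) * (g * y) * (x * c)], a product of three elements of [F]
([inverse_factorization]).  This is guided by the egg-box picture of the
D-class of [g]: idempotency of [(x * c) * (g * y)] and of
[g * (c * x)] fixes the sandwich matrix entries that occur when this triple
product is computed.  For the last one to be a product of three elements of
[F], one writes [g] as [(g * y) * (y * g)], which is possible because
[y = (y * g) * (g * y)] is idempotent. *)

Set Implicit Arguments.
Unset Strict Implicit.
Unset Printing Implicit Defensive.

Local Open Scope classical_set_scope.
Local Open Scope group_scope.

(** * Preservation of equation systems *)

Section Extend.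
Variable T : Type.

(** With [s] concrete, the right-hand side computes, whereas [unlift] is
blocked by opaque proofs. *)
Lemma extend_nth n x0 (s : seq T) x : size s = n ->
  extend (fun i : 'I_n => nth x0 s i) x
  = fun i : 'I_n.+1 => nth x0 (rcons s x) i.
Proof.
move=> size_s; apply/funext => i; rewrite /extend nth_rcons size_s.
case: unliftP => [j ->|->] /=; last by rewrite ltnn eqxx.
have -> : bump n j = j by rewrite /bump leqNgt ltn_ord.
by rewrite ltn_ord.
Qed.

Lemma extend_comp (U : Type) (f : T -> U) n (v : 'I_n -> T) x :
  extend (f \o v) (f x) = f \o extend v x.
Proof. by apply/funext => i; rewrite /extend /=; case: unlift. Qed.

End Extend.

Lemma equality_conjunction_prenex n (phi : formula n) :
  equality_conjunction phi -> prenex_equalities phi.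
Proof. by case: phi. Qed.

Lemma eval_morphism (A B : magmaType) (f : {multiplicative A -> B}) n
    (v : 'I_n -> A) t :
  eval (f \o v) t = f (eval v t).
Proof. by elim: t => //= t1 -> t2 ->; rewrite gmulfM. Qed.

Lemma holds_image (A B : magmaType) (f : {multiplicative A -> B}) n
    (phi : formula n) (v : 'I_n -> A) :
  (forall b, exists a, f a = b) -> prenex_equalities phi ->
  holds v phi -> holds (f \o v) phi.
Proof.
move=> f_surj; elim: phi v => {n} //=.
- by move=> n t u v _ tu; rewrite !eval_morphism tu.
- move=> n p IHp q IHq v /andP[/equality_conjunction_prenex pe].
  by move=> /equality_conjunction_prenex qe [hp hq]; split; auto.
- move=> n p IHp v pe hp b; have [a <-] := f_surj b.
  by rewrite extend_comp; exact: IHp.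
- by move=> n p IHp v pe [a hp]; exists (f a); rewrite extend_comp; exact: IHp.
Qed.

Section Product.
Variables (I : Type) (A : I -> magmaType).

Lemma eval_product n (v : 'I_n -> (direct_product A : magmaType)) t i :
  eval v t i = eval (fun k => v k i) t.
Proof. by elim: t => //= t1 <- t2 <-. Qed.

Lemma extend_product n (v : 'I_n -> direct_product A) x i :
  (fun k => extend v x k i) = extend (fun k => v k i) (x i).
Proof. exact/esym/(extend_comp (fun a : direct_product A => a i)). Qed.

Lemma holds_product n (phi : formula n)
    (v : 'I_n -> (direct_product A : magmaType)) :
  prenex_equalities phi ->
  (forall i, holds (fun k => v k i) phi) -> holds v phi.
Proof.
elim: phi v => {n} //=.
- move=> n t u v _ tu; apply: functional_extensionality_dep => i.
  by rewrite !eval_product.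
- move=> n p IHp q IHq v /andP[/equality_conjunction_prenex pe].
  move=> /equality_conjunction_prenex qe hpq.
  by split; [apply: IHp | apply: IHq] => // i; case: (hpq i).
- by move=> n p IHp v pe hp x; apply: IHp => // i; rewrite extend_product.
- move=> n p IHp v pe hp; exists (fun i => sval (cid (hp i))).
  by apply: IHp => // i; rewrite extend_product; case: (cid (hp i)).
Qed.

End Product.

Lemma satisfies_E_closed (phi : formula 0) :
  E_closed (fun S => satisfies S phi).
Proof.
move=> A B f f_elem; rewrite /satisfies.
have -> : @empty_valuation B = f \o @empty_valuation A.
  by apply/funext; case.
by move/f_elem.
Qed.

Lemma equation_system_H_closed (phi : formula 0) :
  equation_system phi -> H_closed (fun S => satisfies S phi).
Proof.
move=> phi_eq A B f f_surj; rewrite /satisfies.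
have -> : @empty_valuation B = f \o @empty_valuation A.
  by apply/funext; case.
exact: holds_image.
Qed.

Lemma equation_system_P_closed (phi : formula 0) :
  equation_system phi -> P_closed (fun S => satisfies S phi).
Proof.
move=> phi_eq I A hA; apply: holds_product => // i.
have -> : (fun k => @empty_valuation (direct_product A) k i)
          = @empty_valuation (A i) by apply/funext; case.
exact: hA.
Qed.

(** * The two sentences *)

Definition associativity : formula 0 :=
  let x := Var (@Ordinal 3 0 isT) in
  let y := Var (@Ordinal 3 1 isT) in
  let z := Var (@Ordinal 3 2 isT) in
  All (All (All (Eq (Mul x (Mul y z)) (Mul (Mul x y) z)))).

Lemma satisfies_associativity (S : magmaType) :
  satisfies S associativity <-> semigroup S.
Proof.
have valE (x y z : S) :
    extend (extend (extend (@empty_valuation S) x) y) z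
    = fun i => nth x [:: x; y; z] i.
  have -> : @empty_valuation S = fun i => nth x [::] i by apply/funext; case.
  by rewrite !extend_nth.
rewrite /satisfies /=; split=> mA x y z; have := mA x y z; by rewrite valE.
Qed.

Lemma satisfies_orthodox_system (S : magmaType) :
  satisfies S orthodox_system <-> orthodox_condition S.
Proof.
have valE (a b x y : S) :
    extend (extend (extend (extend (@empty_valuation S) a) b) x) y
    = fun i => nth a [:: a; b; x; y] i.
  have -> : @empty_valuation S = fun i => nth a [::] i by apply/funext; case.
  by rewrite !extend_nth.
rewrite /satisfies /orthodox_condition /=.
split=> cond a b; have [x [y]] := cond a b.
- rewrite valE /= => H; exists x, y.
  split; [by split; tauto | by split; tauto |].
  move=> /= g1 g2 g3 [[[->|->]|->]|->] [[[->|->]|->]|->] [[[->|->]|->]|->];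
    rewrite /idempotents /=; tauto.
- move=> [[axa xax] [byb yby] cond3]; exists x, y; rewrite valE /=.
  by do ![split=> //]; apply: cond3; rewrite /=; tauto.
Qed.

(** * From orthodoxy to the condition *)

Section OrthodoxSemigroups.
Variable S : magmaType.
Hypothesis mA : semigroup S.
Implicit Types a b c e f g x y z t : S.

Let inverse_sandwich a x : inverses a x -> forall t, t * a * x * a = t * a.
Proof. by move=> [axa _] t; rewrite -!mA (mA a) axa. Qed.

Lemma inversesC a x : inverses a x -> inverses x a.
Proof. by case. Qed.

Lemma regular_has_inverse : regular S -> forall a, exists x, inverses a x.
Proof.
move=> reg a; have [x axa] := reg a; exists (x * a * x).
have E t : t * a * x * a = t * a by rewrite -!mA (mA a) axa.
by split; rewrite !mA ?E // axa.
Qed.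

Lemma orthodox_orthodox_condition : orthodox S -> orthodox_condition S.
Proof.
move=> [_ reg idM] a b.
have [x ax] := regular_has_inverse reg a.
have [y bY] := regular_has_inverse reg b.
exists x, y; split=> // F g1 g2 g3.
have id_mul c z : inverses c z -> idempotents (c * z).
  by move=> [czc _]; rewrite /idempotents /= mA czc.
have idF g : F g -> idempotents g.
  by move=> [[[->|->]|->]|->]; apply: id_mul => //; apply: inversesC.
by move=> /idF i1 /idF i2 /idF i3; apply: (idM _ _ (idM _ _ i1 i2)).
Qed.

(** * From the condition to orthodoxy *)

(** This is the element of the sandwich set of [e] and [f] determined by [z]. *)
Lemma mul_idempotents_inverse e f z :
  idempotents e -> idempotents f -> inverses (e * f) z ->
  let g := f * z * e in idempotents g /\ inverses g (e * f).
Proof.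
rewrite /idempotents /= => ee ff [efz zef].
have zE t : t * z * e * f * z = t * z.
  by rewrite -!mA; congr (_ * _); rewrite -[RHS]zef !mA.
have eE t : t * e * e = t * e by rewrite -mA -ee.
have fE t : t * f * f = t * f by rewrite -mA -ff.
split; first by rewrite !mA zE.
split; first by rewrite !mA eE fE zE.
by rewrite !mA fE eE -[RHS]efz !mA.
Qed.

(** Each idempotency hypothesis, multiplied on the left by [c] and on the right
by [c] or [g * c], collapses through [c * g * c = c], [c * x * c = c] and
[g * y * g = g] to an expression for [c].  The second such expression gives
[g * y * x * c = g * c], which reduces the factorization to the first. *)
Lemma inverse_factorization c g x y :
  inverses g c -> inverses c x -> inverses g y ->
  idempotents (g * c * x) -> idempotents (x * c * g * y) ->
  c = c * x * (g * y) * (x * c).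
Proof.
move=> gc cx gy; rewrite /idempotents /= => i1 i2.
have [[gcg cgc] [cxc _]] := (gc, cx).
have gcgE := inverse_sandwich gc.
have cgcE := inverse_sandwich (inversesC gc).
have cxcE := inverse_sandwich cx.
have gygE := inverse_sandwich gy.
have cxgc : c * x * g * c = c.
  have : c * (g * c * x) * c = c by rewrite !mA cgc cxc.
  by rewrite i1 !mA cgc cxcE.
have cgyxc : c * g * y * x * c = c.
  have : c * (x * c * g * y) * (g * c) = c by rewrite !mA cxc gygE cgc.
  by rewrite i2 !mA cxc gygE cgcE.
have gyxc : g * y * x * c = g * c.
  by rewrite -[in RHS]cgyxc !mA gcg.
by rewrite -[LHS]cxgc -mA -gyxc !mA.
Qed.

Lemma orthodox_condition_inverse_idempotent c g :
  orthodox_condition S -> idempotents g -> inverses g c -> idempotents c.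
Proof.
move=> cond gg gc; have [x [y [cx gy]]] := cond c g.
set F := (F in let _ := F in _) => /= idF.
have Fcx : F (c * x) by rewrite /F /=; tauto.
have Fxc : F (x * c) by rewrite /F /=; tauto.
have Fgy : F (g * y) by rewrite /F /=; tauto.
have Fyg : F (y * g) by rewrite /F /=; tauto.
have [gyg ygy] := gy.
have gE t : t * g * g = t * g by rewrite -mA -gg.
have yy : y * y = y.
  have -> : y = y * g * (y * g) * (g * y) by rewrite !mA gE ygy ygy.
  by rewrite -(idF _ _ _ Fyg Fyg Fgy).
have gyyg : g * y * (y * g) = g by rewrite !mA -(mA g y y) yy.
rewrite (@inverse_factorization c g x y) //; first exact: idF.
- by rewrite -mA -gyyg; exact: idF.
- have -> : x * c * g * y = x * c * (x * c) * (g * y).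
    by case: cx => _ xcx; rewrite !mA xcx.
  exact: idF.
Qed.

Lemma orthodox_condition_orthodox : orthodox_condition S -> orthodox S.
Proof.
move=> cond; split=> // [a|e f ee ff].
  by have [x [_ [[axa _] _ _]]] := cond a a; exists x.
have [z [_ [efz _ _]]] := cond (e * f) (e * f).
have [gg gef] := mul_idempotents_inverse ee ff efz.
exact: orthodox_condition_inverse_idempotent gg gef.
Qed.

Lemma orthodoxP : orthodox S <-> orthodox_condition S.
Proof.
split; [exact: orthodox_orthodox_condition|exact: orthodox_condition_orthodox].
Qed.

End OrthodoxSemigroups.

Lemma orthodox_satisfies (S : magmaType) :
  orthodox S <-> satisfies S associativity /\ satisfies S orthodox_system.
Proof.
rewrite satisfies_associativity satisfies_orthodox_system.
by split=> [oS|[mA /(orthodoxP mA)]] //; have [mA _ _] := oS; split=> //;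
  apply/(orthodoxP mA).
Qed.

Theorem theorem4p2 :
  [/\ EHP_class_of_semigroups orthodox,
      equation_system orthodox_system,
      forall S : magmaType, semigroup S ->
        (orthodox S <-> satisfies S orthodox_system)
    & forall S : magmaType, semigroup S ->
        (orthodox S <-> orthodox_condition S)].
Proof.
split=> //; last exact: orthodoxP; last first.
  by move=> S mA; rewrite satisfies_orthodox_system; exact: orthodoxP.
split.
- by move=> S [].
- move=> A B f f_elem /orthodox_satisfies[hB1 hB2]; apply/orthodox_satisfies.
  by split; apply: satisfies_E_closed f_elem _.
- move=> A B f f_surj /orthodox_satisfies[hA1 hA2]; apply/orthodox_satisfies.
  by split; apply: equation_system_H_closed f_surj _.
- move=> I A hA; apply/orthodox_satisfies.
  by split; apply: equation_system_P_closed => // i;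
    have /orthodox_satisfies[] := hA i.
Qed.
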